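(* Let $a$ and $b$ be relatively prime positive integers with $a<b$, and let $t\in\mathbb{R}$ with $0\le t<b$. Then \[ \mathrm{r}_{-t}(a,b)+\mathrm{r}_t(b,a)=\frac1{12}\left(\frac ab+\frac1{ab}+\frac ba\right)-\frac14+\frac1{2ab}\lfloor t\rfloor\left(\lfloor t\rfloor+1\right)-\frac12\left\lfloor\frac ta\right\rfloor-\frac{\chi}{2}\left(\left(\!\left(\frac{a^{-1}t}{b}\right)\!\right)+\left(\!\left(\frac{b^{-1}t}{a}\right)\!\right)\right), \] where $\chi$ equals $1$ if $t\in\mathbb{Z}$ and $0$ otherwise, and $a^{-1}$, $b^{-1}$ are integers with $a\,a^{-1}\equiv1\pmod b$ and $b\,b^{-1}\equiv1\pmod a$.
   Context: The sawtooth function is $((x)):=x-\lfloor x\rfloor-\frac12$ if $x\in\mathbb{R}\setminus\mathbb{Z}$ and $((x)):=0$ if $x\in\mathbb{Z}$. For $a,b\in\mathbb{Z}_{>0}$ and $t\in\mathbb{R}$, the Dedekind--Rademacher sum is \[ \mathrm{r}_t(a,b):=\sum_{k=0}^{b-1}\left(\!\left(\frac{ka+t}{b}\right)\!\right)\left(\!\left(\frac kb\right)\!\right). \] *)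

(* Defs.v *)
From mathcomp Require Import all_boot all_order all_algebra.
From mathcomp Require Import reals.

Set Implicit Arguments.
Unset Strict Implicit.
Unset Printing Implicit Defensive.

Import Order.TTheory GRing.Theory Num.Theory.
Local Open Scope ring_scope.

Definition sawtooth (R : realType) (x : R) : R :=
  if x \is a Num.int then 0 else x - (Num.floor x)%:~R - 2^-1.

Definition rademacher_sum (R : realType) (t : R) (a b : nat) : R :=
  \sum_(0 <= k < b) sawtooth ((k%:R * a%:R + t) / b%:R) * sawtooth (k%:R / b%:R).

(* Main.v *)
Require Import Defs.
From mathcomp Require Import all_boot all_order all_algebra.
From mathcomp Require Import reals.
From mathcomp Require Import zify ring lra.

Set Implicit Arguments.
Unset Strict Implicit.
Unset Printing Implicit Defensive.

Import Order.TTheory GRing.Theory Num.Theory.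
Local Open Scope ring_scope.

(** Why the formula holds.  Write n = floor t.

    Off the integers, ((x)) is the fractional part of x minus 1/2, so the value
    (((t + z)/d)) depends on t only through the residue of n + z modulo d,
    the fractional part of t, and a correction 1/2 when t is an integer and d
    divides t + z (sawtooth_shift).  Because the weights ((k/d)) sum to 0 over a
    period, the fractional part of t and the constant 1/2 disappear from
    rademacher_sum.  The corrections select the one k with k c = t modulo d,
    and they give the two sawtooth terms in chi (sum_sawtooth_residue).  What
    is left is an identity about residue_diff n, a difference of two sums of
    residues weighted by sawtooth values, for an integer 0 <= n < b.

    Passing from n to n + 1 raises each residue by 1, except for the one that
    drops from d - 1 to 0; so the increment of residue_diff is the value at
    m = n + 1 of ((a'm/b)) + ((b'm/a)).  As a a' + b b' = 1 modulo a b, the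
    fractional parts of a'm/b and b'm/a add up to m/(ab) modulo 1, and for
    0 < m < b they add up to m/(ab) + 1 if a does not divide m, and to m/(ab)
    otherwise (sawtooth_inverse_pair).  Summing the increments gives the terms
    n(n+1)/(2ab) and -floor(n/a)/2 (residue_diffE).

    The initial value residue_diff 0, which is the classical reciprocity law
    for Dedekind sums, then comes from averaging over n.  Summed over
    0 <= n < b, the sum of residues modulo b becomes a constant times the sum of
    the weights, that is 0.  The sum of residues modulo a turns into a sum over
    m = n + j b in [0, ab) of (m mod a) floor(m/b), up to simple terms; since
    b floor(m/b) = m - (m mod b), its value follows from the Chinese remainder
    theorem (sum_modn_divn).  The remaining sum of n mod a over n < b, which
    has no closed form, occurs in the same way on both sides and cancels
    (residue_diff0). *)

(** * Affine maps modulo d *)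

(** For c invertible modulo d, the map k |-> n + k c permutes the residues
    modulo d. *)
Lemma sum_affine (V : nmodType) (d : nat) (n c c' : int) (f : int -> V) :
  (0 < d)%N -> (c * c' = 1 %[mod d])%Z ->
  (forall x, f (x %% d)%Z = f x) ->
  \sum_(0 <= k < d) f (n + k%:Z * c) = \sum_(0 <= k < d) f k%:Z.
Proof.
case: d => // d _ cc' fmod.
pose r (k : 'I_d.+1) : 'I_d.+1 := inord `|((n + k%:Z * c) %% d.+1%:Z)%Z|.
have rE k : (r k)%:Z = ((n + k%:Z * c) %% d.+1%:Z)%Z.
  have h0 := modz_ge0 (n + k%:Z * c) (_ : d.+1%:Z != 0).
  have h1 := ltz_pmod (n + k%:Z * c) (_ : 0 < d.+1%:Z).
  by rewrite /r inordK; have := h0 isT; have := h1 isT; lia.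
have r_inj : injective r.
  move=> i j eq_r; apply/val_inj/eqP => /=.
  have : (r i)%:Z = (r j)%:Z by rewrite eq_r.
  rewrite !rE => /eqP; rewrite eqz_modDl => /eqP eq_ic.
  have modc (k : 'I_d.+1) : ((k%:Z * c) * c' = k%:Z %[mod d.+1%:Z])%Z.
    by rewrite -mulrA -modzMmr cc' modzMmr mulr1.
  have : (i%:Z = j%:Z %[mod d.+1%:Z])%Z.
    by rewrite -modc -[RHS]modc -modzMml eq_ic modzMml.
  by rewrite !modz_small ?ltz_nat ?ltn_ord //= => -[->].
rewrite !big_mkord [RHS](reindex_inj r_inj).
by apply: eq_bigr => k _; rewrite rE fmod.
Qed.

Lemma inverse_mulz (c c' d z : int) :
  (c * c' = 1 %[mod d])%Z -> (c * (c' * z) = z %[mod d])%Z.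
Proof. by move=> cc'; rewrite mulrA -modzMml cc' modzMml mul1r. Qed.

Lemma dvdz_inverse (c c' d z : int) : (c * c' = 1 %[mod d])%Z ->
  (d %| c' * z)%Z = (d %| z)%Z.
Proof.
move=> cc'; apply/idP/idP => [h|]; last exact: dvdz_mull.
by apply/dvdz_mod0P; rewrite -(inverse_mulz z cc'); apply/dvdz_mod0P/dvdz_mull.
Qed.

(** * Sawtooth values at rational shifts *)

Section Sawtooth.
Variable R : realType.
Implicit Types (t : R) (d : nat) (z n c : int).

Lemma sawtoothN (x : R) : sawtooth (- x) = - sawtooth x.
Proof.
rewrite /sawtooth rpredN; case: ifPn => [|x_int]; first by rewrite oppr0.
suff -> : Num.floor (- x) = - Num.floor x - 1 by rewrite intrB rmorphN /=; lra.
apply: floor_def; rewrite intrEfloor in x_int.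
have /andP[lb ub] := floor_itv x.
have lb' : (Num.floor x)%:~R < x by rewrite lt_neqAle x_int.
rewrite subrK intrB rmorphN /=; rewrite intrD in ub.
by apply/andP; split; lra.
Qed.

(** Dividing n + z by d, with quotient q and remainder r, puts (t + z)/d at
    distance (r + t - n)/d < 1 above q: since r is an integer, r <= d - 1
    leaves room for the fractional part of t. *)
Lemma sawtooth_shift t z d : (0 < d)%N ->
  sawtooth ((t + z%:~R) / d%:R) =
    ((Num.floor t + z) %% d)%Z%:~R / d%:R + (t - (Num.floor t)%:~R) / d%:R
    - 2^-1 + ((t \is a Num.int) && (d %| Num.floor t + z)%Z)%:R / 2%:R.
Proof.
move=> d_gt0; have dR_gt0 : 0 < d%:R :> R by rewrite ltr0n.
have dR_neq0 : d%:R != 0 :> R by rewrite lt0r_neq0.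
set n := Num.floor t; set q := ((n + z) %/ d)%Z; set r := ((n + z) %% d)%Z.
have r_ge0 : 0 <= r by rewrite modz_ge0 // -lt0n.
have r_lt : r + 1 <= d%:Z by rewrite lezD1 ltz_pmod.
have rR_ge0 : 0 <= r%:~R :> R by rewrite ler0z.
have rR_lt : r%:~R + 1 <= d%:R :> R.
  by rewrite -[1]/(1%:~R) -intrD -[d%:R]/(d%:Z%:~R) ler_int.
have /andP[fl fu] := floor_itv t; rewrite intrD -/n in fl fu.
have tz : t + z%:~R = q%:~R * d%:R + (r%:~R + (t - n%:~R)).
  have /(congr1 (fun x => x%:~R : R)) := divz_eq (n + z) d.
  rewrite !(intrD, intrM) -/q -/r -[d%:~R]/(d%:R) => h.
  by rewrite addrA -h; ring.
have xE : (t + z%:~R) / d%:R = q%:~R + (r%:~R + (t - n%:~R)) / d%:R.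
  by rewrite tz mulrDl mulfK.
have fx : Num.floor ((t + z%:~R) / d%:R) = q.
  apply: floor_def; rewrite intrD xE lerDl ltrD2l ltr_pdivrMr // mul1r.
  by apply/andP; split; [apply: divr_ge0; [lra | exact: ltW] | lra].
have int_x : ((t + z%:~R) / d%:R \is a Num.int) =
    ((t \is a Num.int) && (d %| n + z)%Z).
  rewrite intrEfloor fx xE -subr_eq0 opprD addrA subrr add0r oppr_eq0.
  rewrite mulf_eq0 invr_eq0 (negPf dR_neq0) orbF.
  rewrite paddr_eq0 ?subr_ge0 // intr_eq0 [t - _ == 0]subr_eq0 andbC.
  by rewrite [t == _]eq_sym -intrEfloor; congr (_ && _); apply/eqP/dvdz_mod0P.
rewrite /sawtooth int_x fx; case: ifPn => [|_] /=; last by rewrite mul0r xE; ring.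
rewrite intrEfloor -/n => /andP[/eqP <- /dvdz_mod0P]; rewrite -/r => ->.
by rewrite subrr !mul0r; lra.
Qed.

Lemma sawtooth_int z d : (0 < d)%N ->
  sawtooth (z%:~R / d%:R : R) =
    (z %% d)%Z%:~R / d%:R - 2^-1 + (d %| z)%Z%:R / 2%:R.
Proof.
move=> d_gt0; have := sawtooth_shift 0 z d_gt0.
by rewrite floor0 !add0r oppr0 mul0r addr0 rpred0.
Qed.

Lemma sawtooth_modz z d : (0 < d)%N ->
  sawtooth ((z %% d)%Z%:~R / d%:R : R) = sawtooth (z%:~R / d%:R).
Proof.
move=> d_gt0; rewrite !sawtooth_int // modz_mod.
suff -> : (d %| z %% d)%Z = (d %| z)%Z by [].
by apply/dvdz_mod0P/dvdz_mod0P; rewrite modz_mod.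
Qed.

Lemma eq_sawtooth_mod z1 z2 d : (0 < d)%N -> (z1 = z2 %[mod d])%Z ->
  sawtooth (z1%:~R / d%:R : R) = sawtooth (z2%:~R / d%:R).
Proof. by move=> d_gt0 eq_z; rewrite -sawtooth_modz // eq_z sawtooth_modz. Qed.

Lemma sum_id d : \sum_(0 <= k < d) k%:R = d%:R * (d%:R - 1) / 2%:R :> R.
Proof.
elim: d => [|d IHd]; first by rewrite big_geq // !mul0r.
by rewrite big_nat_recr //= IHd -natr1; field.
Qed.

Lemma sum_sqr d :
  \sum_(0 <= k < d) k%:R ^+ 2 = d%:R * (d%:R - 1) * (2%:R * d%:R - 1) / 6%:R :> R.
Proof.
elim: d => [|d IHd]; first by rewrite big_geq // !mul0r.
by rewrite big_nat_recr //= IHd -natr1; field.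
Qed.

Lemma sawtooth_nat k d : (k < d)%N ->
  sawtooth (k%:R / d%:R : R) = k%:R / d%:R - 2^-1 + (k == 0)%N%:R / 2%:R.
Proof.
move=> lt_kd; have d_gt0 : (0 < d)%N by apply: leq_ltn_trans lt_kd.
rewrite -[k%:R]/(k%:Z%:~R) sawtooth_int //.
rewrite modz_small ?ltz_nat //=.
congr (_ + _%:R / _); congr nat_of_bool.
apply/idP/eqP=> [/dvdz_mod0P|->]; last exact: dvdz0.
by rewrite modz_small ?ltz_nat //= => -[].
Qed.

Lemma sum_delta0 d (x : R) : (0 < d)%N ->
  \sum_(0 <= k < d) (k == 0)%N%:R * x = x.
Proof.
move=> d_gt0; rewrite big_ltn // mul1r big_nat big1 ?addr0 // => k /andP[k_gt0 _].
by rewrite eqn0Ngt k_gt0 mul0r.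
Qed.

(** The convention ((0)) = 0 is what makes this sum vanish: it compensates for
    the average of the values k/d falling short of 1/2. *)
Lemma sum_sawtooth d : (0 < d)%N ->
  \sum_(0 <= k < d) sawtooth (k%:R / d%:R) = 0 :> R.
Proof.
move=> d_gt0; have dR_neq0 : d%:R != 0 :> R by rewrite pnatr_eq0 -lt0n.
under eq_big_nat => k /andP[_ lt_kd] do rewrite sawtooth_nat //.
rewrite !big_split /= -mulr_suml sum_id sumr_const_nat subn0 sum_delta0 //.
by rewrite -mulr_natr; field.
Qed.

(** The only term that survives is the one with k = c' n modulo d; it is found
    by taking x = n - k c as the index of summation. *)
Lemma sum_dvdz_sawtooth n c c' d : (0 < d)%N -> (c * c' = 1 %[mod d])%Z ->
  \sum_(0 <= k < d) (d %| n - k%:Z * c)%Z%:R * sawtooth (k%:R / d%:R) =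
    sawtooth ((c' * n)%:~R / d%:R) :> R.
Proof.
move=> d_gt0 cc'.
pose f x : R := (d %| x)%Z%:R * sawtooth ((c' * (n - x))%:~R / d%:R).
have NN : (- c * - c' = 1 %[mod d])%Z by rewrite mulrNN.
transitivity (\sum_(0 <= k < d) f (n + k%:Z * - c)).
  apply: eq_bigr => k _; rewrite /f mulrN; congr (_ * _).
  rewrite -[k%:R]/(k%:Z%:~R); apply: eq_sawtooth_mod => //.
  by rewrite opprB addrC subrK mulrC -mulrA -modzMmr cc' modzMmr mulr1.
rewrite (sum_affine n d_gt0 NN) => [|x]; last first.
  rewrite /f; congr (_%:R * _).
    by congr nat_of_bool; apply/dvdz_mod0P/dvdz_mod0P; rewrite modz_mod.
  apply: eq_sawtooth_mod => //.
  by rewrite -modzMmr -modzDmr -modzNm modz_mod modzNm modzDmr modzMmr.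
rewrite big_ltn // big_nat big1 ?addr0 => [|k /andP[k_gt0 lt_kd]].
  by rewrite /f dvdz0 mul1r subr0.
rewrite /f [(_ %| _)%Z](_ : _ = false) ?mul0r //.
by apply/negP => /dvdz_mod0P; rewrite modz_small ?ltz_nat //= => -[]; lia.
Qed.

(** The part of a Dedekind-Rademacher sum that depends only on the integer part
    n of its parameter.  The multiplier c is an integer, so that c = a and
    c = - b cover the two sums of the reciprocity law. *)
Definition residue_sum n c d : R :=
  \sum_(0 <= k < d) ((n - k%:Z * c) %% d)%Z%:~R / d%:R * sawtooth (k%:R / d%:R).

(** The terms of sawtooth_shift that do not depend on k are multiplied by the
    sum of the weights ((k/d)), which is 0. *)
Lemma sum_sawtooth_residue t c c' d : (0 < d)%N -> (c * c' = 1 %[mod d])%Z ->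
  \sum_(0 <= k < d) sawtooth ((t - (k%:Z * c)%:~R) / d%:R) * sawtooth (k%:R / d%:R) =
    residue_sum (Num.floor t) c d
    + (t \is a Num.int)%:R / 2%:R * sawtooth (c'%:~R * t / d%:R).
Proof.
move=> d_gt0 cc'; rewrite /residue_sum.
transitivity (\sum_(0 <= k < d)
    (((Num.floor t - k%:Z * c) %% d)%Z%:~R / d%:R * sawtooth (k%:R / d%:R)
     + ((t - (Num.floor t)%:~R) / d%:R - 2^-1) * sawtooth (k%:R / d%:R)
     + (t \is a Num.int)%:R / 2%:R *
       ((d %| Num.floor t - k%:Z * c)%Z%:R * sawtooth (k%:R / d%:R)) : R)).
  apply: eq_bigr => k _; rewrite -rmorphN /= sawtooth_shift // -mulnb natrM.
  by ring.
rewrite !big_split /= -!mulr_sumr sum_sawtooth // mulr0 addr0.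
rewrite (sum_dvdz_sawtooth _ d_gt0 cc'); congr (_ + _).
case: (boolP (t \is a Num.int)) => [|_]; last by rewrite !mul0r.
by rewrite intrEfloor => /eqP {2}<-; rewrite intrM.
Qed.

(** Each residue increases by 1, except the one that wraps around from d - 1
    to 0.  The uniform increase contributes nothing, as the weights sum to 0. *)
Lemma residue_sumS n c c' d : (0 < d)%N -> (c * c' = 1 %[mod d])%Z ->
  residue_sum (n + 1) c d =
    residue_sum n c d - sawtooth ((c' * (n + 1))%:~R / d%:R).
Proof.
move=> d_gt0 cc'; rewrite -(sum_dvdz_sawtooth _ d_gt0 cc').
have dR_neq0 : d%:R != 0 :> R by rewrite pnatr_eq0 -lt0n.
(* Write the uniform increase 1/d into the goal as a sum equal to 0. *)
rewrite -[residue_sum n c d]addr0 -[X in _ + X - _](mulr0 d%:R^-1).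
rewrite -[X in d%:R^-1 * X](sum_sawtooth d_gt0) /residue_sum.
rewrite mulr_sumr -big_split -sumrB /=; apply: eq_bigr => k _.
rewrite addrAC; set m := n - _; rewrite -mulrDl -mulrBl; congr (_ * _).
suff -> : ((m + 1) %% d)%Z = (m %% d)%Z + 1 - d%:Z * (d %| m + 1)%Z%:R.
  by rewrite rmorphB rmorphD rmorphM /= -[d%:~R]/(d%:R) rmorph_nat; field.
have m_ge0 : 0 <= (m %% d)%Z by rewrite modz_ge0 // -lt0n.
have m_lt : (m %% d)%Z + 1 <= d%:Z by rewrite lezD1 ltz_pmod.
case: (boolP (d %| m + 1)%Z) => /dvdz_mod0P.
  move=> h; rewrite h; apply/eqP; rewrite eq_sym mulr1 subr_eq0.
  rewrite eq_le m_lt leNgt; apply/negP => lt; move: h.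
  by rewrite -modzDml modz_small ?lt ?andbT; lia.
rewrite mulr0 subr0 -modzDml => nz; rewrite modz_small //.
rewrite lt_neqAle m_lt andbT addr_ge0 //=.
by apply/eqP => h; apply: nz; rewrite h modzz.
Qed.

(** * Reciprocity for integer shifts *)

Lemma sum_blocks (a b : nat) (h : nat -> R) :
  \sum_(0 <= m < a * b) h m =
    \sum_(0 <= j < a) \sum_(0 <= n < b) h (n + j * b)%N.
Proof.
rewrite big_nat_mul; apply: eq_bigr => j _.
by rewrite -{1}[(j * b)%N]add0n big_addn mulSn addnK.
Qed.

Section Reciprocity.
Variables (a b : nat) (a' b' : int).
Hypotheses (a_gt0 : (0 < a)%N) (b_gt0 : (0 < b)%N) (co_ab : coprime a b).
Hypothesis aa' : (a%:Z * a' = 1 %[mod b%:Z])%Z.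
Hypothesis bb' : (b%:Z * b' = 1 %[mod a%:Z])%Z.

Let aR_neq0 : a%:R != 0 :> R. Proof. by rewrite pnatr_eq0 -lt0n. Qed.
Let bR_neq0 : b%:R != 0 :> R. Proof. by rewrite pnatr_eq0 -lt0n. Qed.

(** With u = a' m mod b and v = b' m mod a, the number u a + v b is congruent
    to m modulo both a and b, hence modulo a b, and lies in [0, 2ab).  If a
    divides m then v = 0 and u a < ab forces u a = m; otherwise v b >= b > m
    forces u a + v b = m + ab. *)
Lemma sawtooth_inverse_pair m : (0 < m < b)%N ->
  sawtooth ((a' * m%:Z)%:~R / b%:R) + sawtooth ((b' * m%:Z)%:~R / a%:R) =
    m%:R / (a%:R * b%:R) - (a %| m)%N%:R / 2%:R :> R.
Proof.
move=> /andP[m_gt0 m_lt].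
rewrite !sawtooth_int // (dvdz_inverse _ aa') (dvdz_inverse _ bb').
rewrite [(b%:Z %| m%:Z)%Z](_ : _ = false); last first.
  by apply/negP => /dvdz_mod0P; rewrite modz_small ?ltz_nat //= => -[]; lia.
rewrite [(a%:Z %| m%:Z)%Z](_ : _ = (a %| m)%N) //.
set u := ((a' * m) %% b)%Z; set v := ((b' * m) %% a)%Z.
have [u_ge0 v_ge0] : 0 <= u /\ 0 <= v by rewrite !modz_ge0 // -lt0n.
have [u_lt v_lt] : u < b /\ v < a by rewrite !ltz_pmod.
have dvd_ab : (a%:Z * b%:Z %| u * a + v * b - m%:Z)%Z.
  rewrite Gauss_dvdz //; apply/andP; split; rewrite -eqz_mod_dvd; apply/eqP.
    by rewrite modzMDl mulrC -modzMmr modz_mod modzMmr (inverse_mulz _ bb').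
  by rewrite addrC modzMDl mulrC -modzMmr modz_mod modzMmr (inverse_mulz _ aa').
have v0 : (v == 0) = (a %| m)%N.
  rewrite [RHS](_ : _ = (a%:Z %| m%:Z)%Z) // -(dvdz_inverse _ bb').
  by apply/eqP/dvdz_mod0P.
clearbody u v.
have uv : u * a + v * b = m%:Z + a%:Z * b%:Z * (~~ (a %| m)%N)%:R.
  case/dvdzP: dvd_ab => w; set P := a%:Z * b%:Z => wE.
  have P_gt0 : 0 < P by rewrite mulr_gt0.
  have ltP : m%:Z < P by rewrite (@lt_le_trans _ _ b%:Z) ?ler_peMl ?ltz_nat.
  have uP : u * a < P by rewrite /P mulrC ltr_pM2l.
  have vP : v * b < P by rewrite ltr_pM2r.
  have ua_ge0 : 0 <= u * a by rewrite mulr_ge0.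
  have vb_ge0 : 0 <= v * b by rewrite mulr_ge0.
  rewrite -v0; case: eqP => [v_eq0|/eqP v_neq0] /=.
    rewrite v_eq0 mul0r addr0 in wE *.
    have w_lt : w < 1 by rewrite -(ltr_pM2r P_gt0) mul1r; lia.
    have w_gt : - 1 < w by rewrite -(ltr_pM2r P_gt0) mulN1r; lia.
    have w0 : w = 0 by lia.
    by rewrite w0 mul0r in wE; lia.
  (* Here v >= 1, so v b >= b > m excludes u a + v b = m. *)
  have vb_gt : m%:Z < v * b.
    by rewrite (@lt_le_trans _ _ b%:Z) ?ler_peMl ?ltz_nat //; lia.
  have w_lt : w < 2 by rewrite -(ltr_pM2r P_gt0); lia.
  have w_gt : 0 < w by rewrite -(ltr_pM2r P_gt0) mul0r; lia.
  have w1 : w = 1 by lia.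
  by rewrite w1 mul1r in wE; lia.
have /(congr1 (fun x => x%:~R : R)) := uv.
rewrite !(intrD, intrM) -!pmulrn => uvR.
suff : u%:~R / b%:R + v%:~R / a%:R = m%:R / (a%:R * b%:R) + (~~ (a %| m)%N)%:R :> R.
  by case: (a %| m)%N => /= h; lra.
have -> : u%:~R / b%:R + v%:~R / a%:R =
    (u%:~R * a%:R + v%:~R * b%:R) / (a%:R * b%:R) :> R.
  by field; rewrite aR_neq0 bR_neq0.
rewrite uvR; case: (a %| m)%N => /=; by field; rewrite aR_neq0 bR_neq0.
Qed.

Definition residue_diff n : R := residue_sum n (- b%:Z) a - residue_sum n a b.

(** The increments m/(ab) - [a | m]/2 are summed over 0 < m <= n. *)
Lemma residue_diffE (n : nat) : (n < b)%N ->
  residue_diff n = residue_diff 0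
    + n%:R * (n%:R + 1) / (2%:R * a%:R * b%:R) - (n %/ a)%N%:R / 2%:R.
Proof.
have NN : (- b%:Z * - b' = 1 %[mod a])%Z by rewrite mulrNN.
elim: n => [|n IHn] n_lt; first by rewrite div0n !mul0r addr0 subr0.
have -> : residue_diff n.+1 = residue_diff n
    + (sawtooth ((a' * n.+1%:Z)%:~R / b%:R)
       + sawtooth ((b' * n.+1%:Z)%:~R / a%:R)).
  rewrite /residue_diff -[n.+1]addn1 PoszD (residue_sumS _ a_gt0 NN).
  rewrite (residue_sumS _ b_gt0 aa') mulNr rmorphN mulNr sawtoothN opprK.
  by ring.
rewrite (sawtooth_inverse_pair (m := n.+1)) // IHn ?(ltnW n_lt) //.
rewrite divnS // natrD -natr1.
by field; rewrite aR_neq0 bR_neq0.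
Qed.

(** For each k the residue of n - k c runs over a full period together with n,
    so its sum does not depend on k and factors out of the sum of the weights. *)
Lemma sum_residue_sum_period c d : (0 < d)%N ->
  \sum_(0 <= n < d) residue_sum n c d = 0.
Proof.
move=> d_gt0; rewrite exchange_big /=.
pose S := \sum_(0 <= n < d) ((n%:Z %% d)%Z%:~R / d%:R : R).
transitivity (\sum_(0 <= k < d) S * sawtooth (k%:R / d%:R : R)); last first.
  by rewrite -mulr_sumr sum_sawtooth // mulr0.
apply: eq_bigr => k _; rewrite -mulr_suml; congr (_ * _).
have one : (1 * 1 = 1 %[mod d])%Z by rewrite mulr1.
rewrite /S -(@sum_affine _ d (- (k%:Z * c)) 1 1 (fun x => (x %% d)%Z%:~R / d%:R)) //.
  by apply: eq_bigr => n _; rewrite mulr1 addrC.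
by move=> x; rewrite modz_mod.
Qed.

(** After replacing b floor(m/b) by m - (m mod b), the mixed sum of
    (m mod a)(m mod b) factors into the sums of all residues modulo a and
    modulo b: writing m = r + q a, the residue of r + q a modulo b runs over
    a full period with q. *)
Lemma sum_modn_divn :
  \sum_(0 <= m < a * b) (m %% a)%N%:R * (m %/ b)%N%:R =
   ((a%:R - 1) * (a%:R * (a%:R - 1) / 2%:R) * (b%:R * (b%:R - 1) / 2%:R)
     + b%:R * (a%:R * (a%:R - 1) * (2%:R * a%:R - 1) / 6%:R)) / b%:R :> R.
Proof.
have divE m : (m %/ b)%N%:R = (m%:R - (m %% b)%N%:R) / b%:R :> R.
  by rewrite {2}(divn_eq m b) natrD natrM addrK mulfK.
under eq_bigr do rewrite divE mulrA.
rewrite -mulr_suml; congr (_ / _).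
under eq_bigr do rewrite mulrBr.
rewrite sumrB mulnC.
have -> : \sum_(0 <= m < b * a) (m %% a)%N%:R * (m %% b)%N%:R =
    (a%:R * (a%:R - 1) / 2%:R) * (b%:R * (b%:R - 1) / 2%:R) :> R.
  rewrite sum_blocks exchange_big /= -!sum_id mulr_suml.
  apply: eq_big_nat => r /andP[_ r_lt].
  under eq_bigr do rewrite addnC modnMDl modn_small //.
  rewrite -mulr_sumr; congr (_ * _).
  rewrite -[RHS](_ : \sum_(0 <= q < b) (q%:Z %% b)%Z%:~R = _); last first.
    by apply: eq_big_nat => q /andP[_ q_lt]; rewrite modz_small ?ltz_nat.
  rewrite -(@sum_affine _ b r a a' (fun x => (x %% b)%Z%:~R)) //.
    by apply: eq_bigr => q _; rewrite -PoszM -PoszD modz_nat addnC.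
  by move=> x; rewrite modz_mod.
have -> : \sum_(0 <= m < b * a) (m %% a)%N%:R * m%:R =
    a%:R * (a%:R * (a%:R - 1) / 2%:R) * (b%:R * (b%:R - 1) / 2%:R)
     + b%:R * (a%:R * (a%:R - 1) * (2%:R * a%:R - 1) / 6%:R) :> R.
  rewrite sum_blocks.
  transitivity (\sum_(0 <= q < b) ((a%:R * (a%:R * (a%:R - 1) / 2%:R)) * q%:R +
     a%:R * (a%:R - 1) * (2%:R * a%:R - 1) / 6%:R : R)).
    apply: eq_bigr => q _; rewrite -sum_sqr -sum_id mulr_sumr mulr_suml -big_split.
    apply: eq_big_nat => r /andP[_ r_lt] /=.
    by rewrite addnC modnMDl modn_small // natrD natrM; ring.
  by rewrite big_split /= -mulr_sumr sum_id sumr_const_nat subn0 -[_ *+ b]mulr_natl; ring.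
by ring.
Qed.

Lemma sum_modn : \sum_(0 <= m < a * b) (m %% a)%N%:R =
  b%:R * (a%:R * (a%:R - 1) / 2%:R) :> R.
Proof.
rewrite mulnC sum_blocks -sum_id mulr_natl -[b in RHS]subn0 -sumr_const_nat.
apply: eq_bigr => q _; apply: eq_big_nat => r /andP[_ r_lt] /=.
by rewrite addnC modnMDl modn_small.
Qed.

(** The pair (n, j) is encoded as m = n + j b, so that j = floor(m/b) and the
    residue is m mod a.  The last sum is the correction at j = 0, where
    ((0)) = 0 differs from 0 - 1/2. *)
Lemma sum_residue_sum_blocks :
  \sum_(0 <= n < b) residue_sum n (- b%:Z) a =
    \sum_(0 <= m < a * b) (m %% a)%N%:R * (m %/ b)%N%:R / a%:R ^+ 2
    - (\sum_(0 <= m < a * b) (m %% a)%N%:R) / (2%:R * a%:R)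
    + (\sum_(0 <= n < b) (n %% a)%N%:R) / (2%:R * a%:R).
Proof.
rewrite exchange_big mulr_suml -sumrB sum_blocks /=.
have -> : (\sum_(0 <= n < b) (n %% a)%N%:R) / (2%:R * a%:R) =
   \sum_(0 <= j < a) (j == 0)%N%:R *
     ((\sum_(0 <= n < b) (n %% a)%N%:R) / (2%:R * a%:R)) :> R.
  by rewrite sum_delta0.
rewrite -big_split; apply: eq_big_nat => j /andP[_ j_lt] /=.
have -> : (j == 0)%N%:R * ((\sum_(0 <= n < b) (n %% a)%N%:R) / (2%:R * a%:R)) =
    \sum_(0 <= n < b) (j == 0)%N%:R * ((n + j * b) %% a)%N%:R / (2%:R * a%:R) :> R.
  rewrite mulr_suml mulr_sumr; apply: eq_bigr => n _.
  by case: eqP => [->|_]; rewrite ?mul0r // mul0n addn0 !mul1r.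
rewrite -big_split; apply: eq_big_nat => n /andP[_ n_lt] /=.
rewrite mulrN opprK -PoszM -PoszD modz_nat sawtooth_nat // -pmulrn.
by rewrite divnDMl // divn_small // add0n; field.
Qed.

(** Both ways of summing residue_diff over 0 <= n < b are compared.  Replacing
    floor(n/a) by (n - (n mod a))/a makes the sum of n mod a over n < b appear
    with the coefficient 1/(2a) on both sides. *)
Lemma residue_diff0 : residue_diff 0 =
  1 / 12%:R * (a%:R / b%:R + 1 / (a%:R * b%:R) + b%:R / a%:R) - 1 / 4%:R.
Proof.
have : \sum_(0 <= n < b) residue_diff n =
  \sum_(0 <= n < b) residue_sum n (- b%:Z) a.
  by rewrite sumrB sum_residue_sum_period // subr0.
rewrite sum_residue_sum_blocks -mulr_suml sum_modn_divn sum_modn.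
have divE m : (m %/ a)%N%:R = (m%:R - (m %% a)%N%:R) / a%:R :> R.
  by rewrite {2}(divn_eq m a) natrD natrM addrK mulfK.
have -> : \sum_(0 <= n < b) residue_diff n = \sum_(0 <= n < b)
  (residue_diff 0 + (n%:R ^+ 2 + n%:R) / (2%:R * a%:R * b%:R) -
   n%:R / (2%:R * a%:R) + (n %% a)%N%:R / (2%:R * a%:R)).
  apply: eq_big_nat => n /andP[_ n_lt]; rewrite residue_diffE // divE.
  by field; rewrite aR_neq0 bR_neq0.
rewrite big_split /= -[X in _ + X]mulr_suml => /addIr.
move: (residue_diff 0) => D.
rewrite !(sumrB, big_split) /= -!mulr_suml big_split /= sum_sqr sum_id.
rewrite sumr_const_nat subn0 -[D *+ b]mulr_natl => h.
have -> : D = (b%:R * D) / b%:R by field.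
rewrite (canRL (addrK _) (canRL (subrK _) h)).
by field; rewrite aR_neq0 bR_neq0.
Qed.

End Reciprocity.
End Sawtooth.

(** * Reciprocity for Dedekind-Rademacher sums *)

Theorem theorem4 (R : realType) (a b : nat) (t : R) (a' b' : int)
  (a_gt0 : (0 < a)%N) (a_lt_b : (a < b)%N) (co_ab : coprime a b)
  (t_ge0 : 0 <= t) (t_lt_b : t < b%:R)
  (aa' : (a%:Z * a' = 1 %[mod b%:Z])%Z)
  (bb' : (b%:Z * b' = 1 %[mod a%:Z])%Z) :
  rademacher_sum (- t) a b + rademacher_sum t b a =
    1 / 12%:R * (a%:R / b%:R + 1 / (a%:R * b%:R) + b%:R / a%:R)
    - 1 / 4%:R
    + 1 / (2%:R * a%:R * b%:R)
        * ((Num.floor t)%:~R * ((Num.floor t)%:~R + 1))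
    - 1 / 2%:R * (Num.floor (t / a%:R))%:~R
    - (t \is a Num.int)%:R / 2%:R
        * (sawtooth (a'%:~R * t / b%:R) + sawtooth (b'%:~R * t / a%:R)).
Proof.
have b_gt0 : (0 < b)%N by apply: ltn_trans a_lt_b.
have NN : (- b%:Z * - b' = 1 %[mod a])%Z by rewrite mulrNN.
have [n floorE] : exists n : nat, Num.floor t = n%:Z.
  by exists `|Num.floor t|%N; rewrite gez0_abs // floor_ge_int.
have n_lt : (n < b)%N by rewrite -ltz_nat -floorE floor_lt_int.
have floor_divE : Num.floor (t / a%:R) = (n %/ a)%N%:Z.
  have aR_gt0 : 0 < a%:R :> R by rewrite ltr0n.
  have /andP[fl fu] := floor_itv t; rewrite floorE in fl fu.
  apply: floor_def; rewrite ler_pdivlMr // ltr_pdivrMr //.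
  rewrite -PoszD -!pmulrn -!natrM addn1; apply/andP; split.
    by apply: le_trans fl; rewrite -pmulrn ler_nat leq_trunc_div.
  by apply: lt_le_trans fu _; rewrite -PoszD -pmulrn ler_nat addn1 ltn_ceil.
(* The sawtooth is odd, so the sum at -t is minus a sum in t - k a. *)
have -> : rademacher_sum (- t) a b = - (residue_sum R n a b
    + (t \is a Num.int)%:R / 2%:R * sawtooth (a'%:~R * t / b%:R)).
  rewrite -floorE -(sum_sawtooth_residue t b_gt0 aa') -sumrN.
  apply: eq_bigr => k _; rewrite -mulNr -sawtoothN; congr (sawtooth _ * _).
  by rewrite -mulNr opprB -PoszM -pmulrn natrM.
have -> : rademacher_sum t b a = residue_sum R n (- b%:Z) a
    - (t \is a Num.int)%:R / 2%:R * sawtooth (b'%:~R * t / a%:R).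
  rewrite -mulrN -sawtoothN -!mulNr -rmorphN /= -floorE.
  rewrite -(sum_sawtooth_residue t a_gt0 NN).
  apply: eq_bigr => k _; congr (sawtooth (_ / _) * _).
  by rewrite mulrN rmorphN opprK /= intrM addrC.
have := residue_diffE R a_gt0 b_gt0 co_ab aa' bb' n_lt.
rewrite (residue_diff0 R a_gt0 b_gt0 co_ab aa' bb') /residue_diff.
rewrite floorE floor_divE -!pmulrn => h.
rewrite -[residue_sum R n (- b%:Z) a](subrK (residue_sum R n a b)) h.
by ring.
Qed.
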